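(* For each positive integer $n$, let $Y_n$ be the number of plateaux of an element of $Q_n$ selected uniformly at random. The distribution of the number of plateaux of elements of $Q_n$ converges to a normal distribution as $n$ goes to infinity; that is, $$\tilde{Y}_n=\frac{Y_n-E(Y_n)}{\sqrt{\mathrm{Var}(Y_n)}}$$ converges in distribution to the standard normal variable $N(0,1)$ as $n\to\infty$.
   Context: For a positive integer $n$, $Q_n$ denotes the set of Stirling permutations: all permutations $q=a_1a_2\cdots a_{2n}$ of the multiset $\{1,1,2,2,\ldots,n,n\}$ such that for every $i\in\{1,\dots,n\}$, all entries located between the two occurrences of $i$ are larger than $i$. An index $i$ with $1\le i\le 2n-1$ is a plateau of $q$ if $a_i=a_{i+1}$. The normalized variable $\tilde Y_n$ is considered for those $n$ with $\mathrm{Var}(Y_n)>0$ (only $n=1$ is excluded). *)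

(* Defs.v *)
From HB Require Import structures.
From mathcomp Require Import all_boot all_order all_algebra.
From mathcomp Require Import all_classical all_reals all_analysis.
From mathcomp Require Import measurable_realfun finmap zify.
Import Order.TTheory GRing.Theory Num.Theory.
Import numFieldNormedType.Exports.

Set Implicit Arguments.
Unset Strict Implicit.
Unset Printing Implicit Defensive.

Local Open Scope ring_scope.
Local Open Scope classical_set_scope.

(* Letters are 'I_n, i.e. {0, ..., n-1} in place of {1, ..., n}.  The first
   conjunct says that q is a rearrangement of the multiset in which every letter
   has multiplicity 2, so j and l in the second conjunct can only be the two
   positions of the letter tnth q j. *)
Definition is_stirling (n : nat) (q : (2 * n).-tuple 'I_n) : bool :=
  perm_eq q (enum 'I_n ++ enum 'I_n) &&
  [forall j : 'I_(2 * n), forall k : 'I_(2 * n),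
     forall l : 'I_(2 * n),
     [&& (j < k)%N, (k < l)%N & tnth q j == tnth q l] ==>
       (tnth q j < tnth q k)%N].

Record stirling (n : nat) := Stirling {
  stirling_word : (2 * n).-tuple 'I_n;
  _ : is_stirling stirling_word }.

HB.instance Definition _ n := [isSub for @stirling_word n].
HB.instance Definition _ n := [Finite of stirling n by <:].

Definition plateaux (n : nat) (q : stirling n) : nat :=
  #|[pred i : 'I_(2 * n) | [exists j : 'I_(2 * n),
      (j == i.+1 :> nat) &&
      (tnth (stirling_word q) i == tnth (stirling_word q) j)]]|.

(* The word 0 0 1 1 2 2 ..., which shows that stirling n is inhabited. *)
Fact stirling0_subproof (n : nat) (i : 'I_(2 * n)) : (i./2 < n)%N.
Proof. by rewrite ltn_half_double -mul2n. Qed.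

Definition stirling0_word (n : nat) : (2 * n).-tuple 'I_n :=
  [tuple Ordinal (stirling0_subproof i) | i < 2 * n].

Fact stirling0P (n : nat) : is_stirling (stirling0_word n).
Proof.
apply/andP; split.
  have -> : tval (stirling0_word n) = flatten [seq [:: x; x] | x <- enum 'I_n].
    apply: (inj_map val_inj); rewrite map_flatten -map_comp.
    transitivity (map (half \o val) (enum 'I_(2 * n))).
      by rewrite -map_comp.
    rewrite map_comp val_enum_ord.
    transitivity (flatten (map (fun k => [:: k; k]) (map val (enum 'I_n)))).
      rewrite val_enum_ord mul2n; elim: n => // n IHn.
      rewrite doubleS -addn2 iotaD map_cat IHn -(addn1 n) iotaD map_cat.
      by rewrite flatten_cat /= !add0n doubleK uphalf_double.
    by elim: (enum 'I_n) => //= x s ->.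
  elim: (enum 'I_n) => //= x s IHs.
  by rewrite perm_cons perm_sym (perm_catCA s [:: x] s) perm_cons perm_sym.
apply/forallP => j; apply/forallP => k; apply/forallP => l; apply/implyP.
rewrite !tnth_mktuple -val_eqE /= => /and3P[jk kl /eqP jl].
have := (odd_double_half j, odd_double_half k, odd_double_half l); lia.
Qed.

HB.instance Definition _ n := isPointed.Build (stirling n) (Stirling (stirling0P n)).

HB.instance Definition _ n := @isMeasurable.Build default_measure_display
  (stirling n) (@discrete_measurable (stirling n)) (@discrete_measurable0 _)
  (@discrete_measurableC _) (@discrete_measurableU _).

Fact measurable_fun_stirling d (T : measurableType d) (n : nat)
  (f : stirling n -> T) : measurable_fun setT f.
Proof. by []. Qed.

Definition stirling_unif (R : realType) (n : nat) : set (stirling n) -> \bar R :=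
  mscale (#|{: stirling n}|%:R^-1)%:nng (@counting (stirling n) R).
Arguments stirling_unif : clear implicits.

HB.instance Definition _ (R : realType) (n : nat) :=
  Measure.on (stirling_unif R n).

Fact stirling_unif_setT (R : realType) (n : nat) : stirling_unif R n setT = 1%E.
Proof.
rewrite /stirling_unif /mscale /= /counting asboolT; last exact: finite_finset.
rewrite (_ : fset_set setT = [fset x in {: stirling n}]%fset); last first.
  apply/fsetP => q; rewrite in_fset_set ?in_setT ?in_fset//.
  exact: finite_finset.
rewrite card_finset /= -EFinM mulVf// pnatr_eq0 -lt0n.
by apply/card_gt0P; exists point.
Qed.

HB.instance Definition _ (R : realType) (n : nat) :=
  Measure_isProbability.Build _ _ R (stirling_unif R n)
    (stirling_unif_setT R n).

Definition plateaux_rv (R : realType) (n : nat) (q : stirling n) : R :=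
  (plateaux q)%:R.
Arguments plateaux_rv : clear implicits.

HB.instance Definition _ (R : realType) (n : nat) :=
  isMeasurableFun.Build _ _ _ _ (plateaux_rv R n)
    (measurable_fun_stirling (plateaux_rv R n)).

(* When the variance is 0, division by 0 makes this the constant 0.  For plateaux
   this happens only at n <= 1 (n = 0 being the empty word), which does not affect
   the limit. *)
Definition normalized d (T : measurableType d) (R : realType)
    (P : probability T R) (X : {RV P >-> R}) : T -> R :=
  fun w => (X w - fine 'E_P[X]) / Num.sqrt (fine 'V_P[X]).
Arguments normalized {d T R} P X _.

Fact measurable_normalized d (T : measurableType d) (R : realType)
  (P : probability T R) (X : {RV P >-> R}) :
  measurable_fun setT (normalized P X).
Proof.
by apply: measurable_funM => //; apply: measurable_funB.
Qed.

HB.instance Definition _ d (T : measurableType d) (R : realType)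
  (P : probability T R) (X : {RV P >-> R}) :=
  isMeasurableFun.Build _ _ _ _ (normalized P X) (measurable_normalized X).

(* The X n may live on different probability spaces, and the limit is given by
   its law mu; convergence is required at the continuity points of the limiting
   distribution function. *)
Definition cvg_in_distribution d (T : nat -> measurableType d) (R : realType)
    (P : forall n, probability (T n) R) (X : forall n, {RV (P n) >-> R})
    (mu : probability (measurableTypeR R) R) : Prop :=
  forall x : R, {for x, continuous (fun y : R => mu `]-oo, y])} ->
    cdf (X n) x @[n --> \oo] --> mu `]-oo, x].
Arguments cvg_in_distribution {d T R} P X mu.

(* Main.v *)
Require Import Defs.
From HB Require Import structures.
From mathcomp Require Import all_boot all_order all_algebra.
From mathcomp Require Import all_classical all_reals all_analysis.
From mathcomp Require Import zify ring lra finmap.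
Import Order.TTheory GRing.Theory Num.Theory.
Import numFieldNormedType.Exports.

Set Implicit Arguments.
Unset Strict Implicit.
Unset Printing Implicit Defensive.

(* Inserting the pair n n into a Stirling permutation of 0, ..., n - 1 creates
   a plateau unless the insertion splits one, so the number of plateaux is a
   Markov chain: from k it stays at k with probability k / (2 n + 1) and moves
   to k + 1 otherwise. Its mean is (2 n + 1) / 3, its variance is
   2 (n ^ 2 - 1) / (9 (2 n - 1)), and suitable multiples c_n of its deviation
   from the mean form a martingale. Lindeberg's replacement argument is run
   backwards from time N with u(y, v) = Phi ((x - y) / sqrt v), an explicit
   solution of u_v = u_yy / 2 coming from a test function that is an indicator
   smoothed by a Gaussian: along u (c_n Z_n, 1 + e - c_n ^ 2 V_n) expectations
   change by O(N ^ (-3/2)) at each step. At n = 1 the value is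
   Phi (x / sqrt (1 + e)), and at n = N it is the smoothed distribution function
   of the normalized variable; finally the smoothing is removed. *)

Local Open Scope nat_scope.

(** * Generating Stirling permutations by insertion *)

Fixpoint nplateaux (s : seq nat) : nat :=
  if s is x :: t then (ohead t == Some x) + nplateaux t else 0.

Definition insert_pair (x i : nat) (s : seq nat) : seq nat :=
  take i s ++ [:: x, x & drop i s].

(** Untyped counterpart of [is_stirling]: with letters in [nat] and words of free length, an
    insertion passes from [n] to [n.+1] without casts. *)
Definition is_stirling_seq (n : nat) (s : seq nat) : Prop :=
  perm_eq s (iota 0 n ++ iota 0 n) /\
  forall j k l, j < k < l -> l < size s -> nth 0 s j = nth 0 s l ->
    nth 0 s j < nth 0 s k.

Fixpoint stirling_seqs (n : nat) : seq (seq nat) :=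
  if n is m.+1 then
    [seq insert_pair m i s | s <- stirling_seqs m, i <- iota 0 (2 * m).+1]
  else [:: [::]].

Lemma nplateaux_size s : nplateaux s <= (size s).-1.
Proof. by elim: s => //= x [|y s] //= IH; case: eqP => _; lia. Qed.

(** Since [x] is fresh, the pair forms no plateau with its neighbours. It adds one plateau of its
    own and destroys one exactly when the gap lies inside a plateau, which happens for [nplateaux s]
    of the [(size s).+1] gaps. *)
Lemma sum_insert_pair (R : nmodType) (f : nat -> R) (x : nat) (s : seq nat) :
  x \notin s ->
  (\sum_(i <- iota 0 (size s).+1) f (nplateaux (insert_pair x i s)) =
   f (nplateaux s) *+ nplateaux s +
   f (nplateaux s).+1 *+ ((size s).+1 - nplateaux s))%R.
Proof.
elim: s f => [|a s IH] f xs.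
  by rewrite /= big_seq1 /insert_pair /= eqxx mulr0n add0r.
move: xs; rewrite inE negb_or => /andP[xa xs].
(* The shift in [f] accounts for the possible plateau between [a] and the head of [s]; this is why
   the induction is general in [f]. *)
have {}IH := IH (fun k => f ((ohead s == Some a) + k)) xs.
have iotaS m n : iota m n.+1 = m :: iota m.+1 n by [].
rewrite iotaS big_cons -[1]addn0 iotaDl big_map.
have noteq y z : y != z -> (Some y == Some z) = false.
  by move=> yz; apply/eqP => -[E]; rewrite E eqxx in yz.
have ins0 : nplateaux (insert_pair x 0 s) = (nplateaux s).+1.
  rewrite /insert_pair take0 drop0 /= eqxx; case: s xs {IH} => //= y s.
  by rewrite inE negb_or eq_sym => /andP[xy _]; rewrite noteq.
have -> : nplateaux (insert_pair x 0 (a :: s)) = (nplateaux (a :: s)).+1.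
  by rewrite /insert_pair /= eqxx noteq // eq_sym.
rewrite [size (a :: s)]/= iotaS big_cons.
rewrite iotaS big_cons in IH.
(* At the gap just after [a] a possible plateau [a a] is split, so the count is the same whether or
   not [s] starts with [a]. *)
have -> : nplateaux (insert_pair x (1 + 0) (a :: s)) = (nplateaux s).+1.
  by rewrite -ins0 /insert_pair add1n /= take0 drop0 /= noteq.
(* At later gaps the head of [s] stays next to [a], so the contribution of [a] is unchanged and the
   induction hypothesis applies. *)
rewrite (eq_big_seq (fun i => f ((ohead s == Some a) + nplateaux (insert_pair x i s)))).
  move: IH; rewrite ins0 /=.
  have := nplateaux_size s.
  case: (ohead s == Some a) / eqP => E P.
    rewrite !add1n => IH.
    rewrite addrCA IH addrA -mulrS; congr (_ + _)%R.
  rewrite !add0n => ->.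
  rewrite addrCA; congr (_ + _)%R.
  by rewrite -mulrS; congr (_ *+ _)%R; lia.
move=> i; rewrite mem_iota => /andP[i1 i2].
rewrite /insert_pair add1n /=; congr (f (_ + _)).
by case: i i1 i2 => [|i] // _; case: (s).
Qed.

(** Together with [filter_insert_pair] this recovers both the position and the word from the result
    of an insertion, hence the absence of repetitions in [stirling_seqs]. *)
Lemma insert_pair_index x i s : x \notin s -> i <= size s ->
  index x (insert_pair x i s) = i.
Proof.
move=> xs si; rewrite /insert_pair index_cat.
have /negbTE -> : x \notin take i s by apply: contra xs; exact: mem_take.
by rewrite /= eqxx addn0 size_takel.
Qed.

Lemma filter_insert_pair x i s : x \notin s ->
  [seq y <- insert_pair x i s | predC1 x y] = s.
Proof.
move=> xs; rewrite /insert_pair filter_cat /= eqxx /= -filter_cat cat_take_drop.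
by apply/all_filterP/allP => y ys /=; apply: contraNneq xs => <-.
Qed.

Lemma perm_insert_pair x i s : perm_eq (insert_pair x i s) (x :: x :: s).
Proof.
rewrite /insert_pair -[X in perm_eq _ [:: _, _ & X]](cat_take_drop i s).
by rewrite (perm_catCA (take i s) [:: x; x]).
Qed.

Lemma perm_iota2S n s : perm_eq (n :: n :: s) (iota 0 n.+1 ++ iota 0 n.+1) =
  perm_eq s (iota 0 n ++ iota 0 n).
Proof.
have : perm_eq (iota 0 n.+1 ++ iota 0 n.+1) (n :: n :: (iota 0 n ++ iota 0 n)).
  rewrite -addn1 iotaD add0n /= -!catA.
  by rewrite perm_catCA /= perm_cons -cat1s catA perm_catC /= perm_refl.
move=> /permPr ->; by rewrite !perm_cons.
Qed.

Lemma nth_insert_pair x i s k : i <= size s ->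
  nth 0 (insert_pair x i s) k =
  if k < i then nth 0 s k else if k < i.+2 then x else nth 0 s (k - 2).
Proof.
move=> si; rewrite /insert_pair nth_cat size_takel //.
case: ltnP => ki; first by rewrite nth_take.
case: ltnP => ki2.
  have [->|->] : k = i \/ k = i.+1 by lia.
    by rewrite subnn.
  by rewrite subSnn.
have -> : k - i = (k - 2 - i).+2 by lia.
by rewrite /= nth_drop subnKC //; lia.
Qed.

(** The two new letters are adjacent, so they enclose nothing, and they exceed every old letter, so
    they may stand between any old pair. *)
Lemma is_stirling_seq_insert n i s : i <= size s ->
  is_stirling_seq n s -> is_stirling_seq n.+1 (insert_pair n i s).
Proof.
move=> si [ps nest]; split.
  by rewrite (permPl (perm_insert_pair _ _ _)) perm_iota2S.
have lt_n k : k < size s -> nth 0 s k < n.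
  move=> ks; have : nth 0 s k \in s by exact: mem_nth.
  by rewrite (perm_mem ps) mem_cat !mem_iota; lia.
move=> j k l /andP[jk kl]; rewrite (perm_size (perm_insert_pair _ _ _)) /= => ls.
rewrite !nth_insert_pair //.
case: (ltnP j i) => ji.
  have jn := lt_n j; case: (ltnP l i) => li.
    have -> : k < i by lia.
    by apply: nest; lia.
  case: (ltnP l i.+2) => li2; first by lia.
  move=> E; have N q : j < q < l - 2 -> nth 0 s j < nth 0 s q.
    by move=> q1; apply: (nest j q (l - 2)) => //; lia.
  case: (ltnP k i) => ki; first by apply: N; lia.
  case: (ltnP k i.+2) => ki2; first by apply: jn; lia.
  by apply: N; lia.
have -> : (l < i) = false by lia.
case: (ltnP l i.+2) => li2.
  by exfalso; lia.
case: (ltnP j i.+2) => ji2.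
  by have := lt_n (l - 2); lia.
have -> : (k < i) = false by lia.
have -> : (k < i.+2) = false by lia.
by apply: nest; lia.
Qed.

(** Nothing can exceed the largest letter [n], so its two copies are adjacent; deleting them leaves
    a word that is still nested. *)
Lemma is_stirling_seq_remove n s : is_stirling_seq n.+1 s ->
  exists i t, [/\ i <= size t, is_stirling_seq n t & s = insert_pair n i t].
Proof.
move=> [ps nest].
have le_n k : k < size s -> nth 0 s k <= n.
  move=> ks; have : nth 0 s k \in s by exact: mem_nth.
  by rewrite (perm_mem ps) mem_cat !mem_iota; lia.
have cn : count_mem n s = 2.
  rewrite (permP ps) count_cat !count_uniq_mem ?iota_uniq // mem_iota; lia.
pose i := index n s; pose t := take i s ++ drop i.+2 s.
have ns : n \in s by rewrite (perm_mem ps) mem_cat mem_iota; lia.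
have is1 : i < size s by rewrite index_mem.
have s_i : nth 0 s i = n by rewrite nth_index.
have cd : count_mem n (drop i.+1 s) = 1.
  move: cn; rewrite -[in X in X -> _](cat_take_drop i s) count_cat.
  rewrite (drop_nth 0) //= s_i eqxx.
  have /count_memPn -> : n \notin take i s by rewrite in_take_leq ?ltnn // ltnW.
  by lia.
have nd : n \in drop i.+1 s by rewrite -has_pred1 has_count cd.
have [m mlt s_m] : exists2 m, i < m < size s & nth 0 s m = n.
  exists (i.+1 + index n (drop i.+1 s)); last by rewrite -nth_drop nth_index.
  move: nd; rewrite -index_mem size_drop; set q := index _ _ => qlt.
  apply/andP; split; last by rewrite -ltn_subRL.
  by rewrite addSn ltnS leq_addr.
(* If the second copy [m] were further away, the entry at [i.+1] would lie strictly between the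
   copies and exceed [n], against [le_n]. *)
have s_i1 : nth 0 s i.+1 = n.
  have [<-//|im] := eqVneq m i.+1.
  have := nest i i.+1 m; rewrite s_i s_m.
  have := le_n i.+1; lia.
have is2 : i.+1 < size s by lia.
have ti : i <= size t by rewrite size_cat size_takel ?leq_addr // ltnW.
have sE : s = insert_pair n i t.
  rewrite /insert_pair /t take_size_cat ?size_takel 1?ltnW //.
  rewrite drop_size_cat ?size_takel 1?ltnW //.
  by rewrite -[LHS](cat_take_drop i) (drop_nth 0) // (drop_nth 0) // s_i s_i1.
exists i, t; split=> //; split.
  by rewrite -perm_iota2S -(permPl (perm_insert_pair n i t)) -sE.
have size_s : size s = (size t).+2 by rewrite sE (perm_size (perm_insert_pair _ _ _)).
have tE k : k < size t -> nth 0 t k = nth 0 s (if k < i then k else k.+2).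
  move=> kt; rewrite [in RHS]sE nth_insert_pair //.
  case: (ltnP k i) => ki; first by rewrite ki.
  have -> : (k.+2 < i) = false by lia.
  by rewrite !ltnS ltnNge ki !subSS subn0.
move=> j k l jkl ls; rewrite !tE; try lia.
by apply: nest; do ?[case: ifP]; lia.
Qed.

Lemma is_stirling_seqS n s : is_stirling_seq n.+1 s <->
  exists i t, [/\ i <= size t, is_stirling_seq n t & s = insert_pair n i t].
Proof.
split; first exact: is_stirling_seq_remove.
by move=> [i [t [it st ->]]]; exact: is_stirling_seq_insert.
Qed.

Lemma is_stirling_seq_size n s : is_stirling_seq n s -> size s = 2 * n.
Proof. by move=> [/perm_size -> _]; rewrite size_cat size_iota mul2n addnn. Qed.

Lemma is_stirling_seq_notin n s : is_stirling_seq n s -> n \notin s.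
Proof. by move=> [/perm_mem/(_ n) -> _]; rewrite mem_cat mem_iota; lia. Qed.

Lemma mem_stirling_seqs n s : s \in stirling_seqs n <-> is_stirling_seq n s.
Proof.
elim: n s => [|n IH] s.
  rewrite inE; split=> [/eqP ->|/is_stirling_seq_size/eqP]; last by rewrite size_eq0.
  by split=> // j k l _; rewrite ltn0.
rewrite is_stirling_seqS; split.
  move=> /allpairsP[[t i] [/IH st]]; rewrite mem_iota => /= it ->.
  by exists i, t; split=> //; rewrite (is_stirling_seq_size st); lia.
move=> [i [t [it st ->]]]; apply/allpairsP; exists (t, i); split=> //; first exact/IH.
by rewrite mem_iota -(is_stirling_seq_size st).
Qed.

Lemma stirling_seqs_uniq n : uniq (stirling_seqs n).
Proof.
elim: n => // n IH; apply: allpairs_uniq => //; first exact: iota_uniq.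
move=> [s i] [t j] /allpairsP[[s' i'] [s's i's [-> ->]]].
move=> /allpairsP[[t' j'] [t't j't [-> ->]]] /= E.
move/mem_stirling_seqs: s's => /= ss; move/mem_stirling_seqs: t't => /= st.
move: i's j't; rewrite !mem_iota /= => i's j't.
have sn := is_stirling_seq_notin ss; have tn := is_stirling_seq_notin st.
have sz := is_stirling_seq_size ss; have tz := is_stirling_seq_size st.
rewrite -(filter_insert_pair i' sn) E (filter_insert_pair j' tn).
by rewrite -(@insert_pair_index n i' s') ?sz // E insert_pair_index ?tz.
Qed.

(** * Transfer from the finite type of Stirling permutations to sequences *)

Definition word_seq n (q : stirling n) : seq nat := map val (stirling_word q).

Lemma size_word_seq n (q : stirling n) : size (word_seq q) = 2 * n.
Proof. by rewrite size_map size_tuple. Qed.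

Lemma nth_word_seq n (q : stirling n) (i : 'I_(2 * n)) :
  nth 0 (word_seq q) i = tnth (stirling_word q) i.
Proof.
case: n q i => [|n] q i; first by case: i.
by rewrite (nth_map ord0) ?size_tuple // (tnth_nth ord0).
Qed.

Lemma word_seqP n (q : stirling n) : is_stirling_seq n (word_seq q).
Proof.
have [/andP[pq /forallP nest]] := valP q; split.
  rewrite (perm_trans (perm_map val pq)) // map_cat val_enum_ord.
  exact: perm_refl.
move=> j k l /andP[jk kl]; rewrite size_word_seq => ln.
have kn : k < 2 * n := ltn_trans kl ln; have jn := ltn_trans jk kn.
rewrite -[j]/(val (Ordinal jn)) -[k]/(val (Ordinal kn)) -[l]/(val (Ordinal ln)).
rewrite !nth_word_seq => /val_inj E.
have /forallP/(_ (Ordinal kn))/forallP/(_ (Ordinal ln))/implyP := nest (Ordinal jn).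
by apply; rewrite /= jk kl E eqxx.
Qed.

Lemma word_seq_inj n : injective (@word_seq n).
Proof. by move=> p q /(inj_map val_inj) /val_inj /val_inj. Qed.

Lemma word_seq_surj n s : is_stirling_seq n s -> exists q : stirling n, word_seq q = s.
Proof.
move=> ss; have sz := is_stirling_seq_size ss; have [ps nest] := ss.
have lt_n k : k < 2 * n -> nth 0 s k < n.
  move=> kn; have : nth 0 s k \in s by rewrite mem_nth // sz.
  by rewrite (perm_mem ps) mem_cat !mem_iota; lia.
pose t := [tuple Ordinal (lt_n i (ltn_ord i)) | i < 2 * n].
have tE : map val t = s.
  apply: (@eq_from_nth _ 0); first by rewrite size_map size_tuple sz.
  move=> i; rewrite size_map size_tuple => i2.
  rewrite (nth_map (Ordinal (lt_n i i2))) ?size_tuple //.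
  by rewrite -[i in nth _ _ i]/(val (Ordinal i2)) -tnth_nth tnth_mktuple.
have st : is_stirling t.
  apply/andP; split.
    by apply: (perm_map_inj val_inj); rewrite tE map_cat val_enum_ord.
  apply/forallP => j; apply/forallP => k; apply/forallP => l.
  apply/implyP => /and3P[jk kl]; rewrite !tnth_mktuple -val_eqE /= => /eqP E.
  by apply: (nest j k l); rewrite ?jk ?kl ?sz.
by exists (Stirling st).
Qed.

Lemma perm_stirling_seqs n :
  perm_eq [seq word_seq q | q <- enum {: stirling n}] (stirling_seqs n).
Proof.
apply: uniq_perm.
- by rewrite map_inj_uniq ?enum_uniq //; exact: word_seq_inj.
- exact: stirling_seqs_uniq.
move=> s; apply/idP/idP.
  by move=> /mapP[q _ ->]; apply/mem_stirling_seqs/word_seqP.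
move=> /mem_stirling_seqs/word_seq_surj[q <-].
by apply/mapP; exists q => //; rewrite mem_enum.
Qed.

Lemma nplateauxE s :
  nplateaux s = \sum_(i < size s) ((i.+1 < size s) && (nth 0 s i == nth 0 s i.+1)).
Proof.
elim: s => [|x s IH]; first by rewrite big_ord0.
rewrite /= big_ord_recl /= IH; congr (_ + _); case: s {IH} => //= y s.
by rewrite eq_sym.
Qed.

Lemma plateauxE n (q : stirling n) : plateaux q = nplateaux (word_seq q).
Proof.
rewrite nplateauxE size_word_seq /plateaux -sum1_card big_mkcond /=.
apply: eq_bigr => i _; rewrite inE nth_word_seq.
suff -> : [exists j : 'I_(2 * n), (j == i.+1 :> nat) &&
    (tnth (stirling_word q) i == tnth (stirling_word q) j)] =
  (i.+1 < 2 * n) && (tnth (stirling_word q) i == nth 0 (word_seq q) i.+1 :> nat).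
  by case: (_ && _).
apply/existsP/andP => [[j /andP[/eqP ji /eqP ->]]|[i1 /eqP E]].
  by rewrite -ji nth_word_seq.
exists (Ordinal i1); rewrite eqxx /=; apply/eqP/val_inj => /=.
by rewrite E -(nth_word_seq q (Ordinal i1)).
Qed.

Lemma big_stirling (R : nmodType) n (f : nat -> R) :
  (\sum_(q : stirling n) f (plateaux q) =
   \sum_(s <- stirling_seqs n) f (nplateaux s))%R.
Proof.
rewrite -(perm_big _ (perm_stirling_seqs n)) /= big_map big_enum /=.
by apply: eq_bigr => q _; rewrite plateauxE.
Qed.

(** Unnormalised transition rule of the Markov chain. The subtraction is truncated, but
    [plateaux_le] makes it exact. *)
Lemma big_stirlingS (R : nmodType) n (f : nat -> R) :
  (\sum_(q : stirling n.+1) f (plateaux q) =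
   \sum_(q : stirling n) (f (plateaux q) *+ plateaux q +
      f (plateaux q).+1 *+ ((2 * n).+1 - plateaux q)))%R.
Proof.
rewrite big_stirling.
rewrite (big_stirling n (fun k => f k *+ k + f k.+1 *+ ((2 * n).+1 - k))%R).
have -> : stirling_seqs n.+1 =
    [seq insert_pair n i s | s <- stirling_seqs n, i <- iota 0 (2 * n).+1] by [].
rewrite big_allpairs_dep; apply: eq_big_seq => s.
move=> /mem_stirling_seqs ss.
by rewrite -(is_stirling_seq_size ss) sum_insert_pair //; exact: is_stirling_seq_notin ss.
Qed.

Lemma plateaux_le n (q : stirling n) : plateaux q <= 2 * n.
Proof. by rewrite plateauxE -(size_word_seq q) (leq_trans (nplateaux_size _)) // leq_pred. Qed.

(** * Averages of functions of the number of plateaux *)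

Local Open Scope classical_set_scope.
Local Open Scope ring_scope.

Lemma card_stirling_gt0 n : (0 < #|{: stirling n}|)%N.
Proof. by apply/card_gt0P; exists (point : stirling n). Qed.

Lemma card_stirlingS n : #|{: stirling n.+1}| = ((2 * n).+1 * #|{: stirling n}|)%N.
Proof.
(* For a constant function the transition rule just counts words, each of which has [(2 * n).+1]
   gaps. *)
have := big_stirlingS n (fun=> 1%R : int).
rewrite sumr_const => E; apply/eqP; rewrite -(eqr_nat int) E.
under eq_bigr => q _.
  rewrite -mulrnDr subnKC; last by have := plateaux_le q; lia.
  over.
by rewrite sumr_const natrM mulr_natr.
Qed.

(** The expectation as a finite quotient, so that the whole limit argument avoids integrals;
    [expectation_plateaux] makes the link. *)
Definition avg (R : realType) n (f : nat -> R) : R :=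
  (\sum_(q : stirling n) f (plateaux q)) / #|{: stirling n}|%:R.

Section average.
Variables (R : realType) (n : nat).
Implicit Types f g : nat -> R.

Lemma eq_avg f g : (forall k, (k <= 2 * n)%N -> f k = g k) -> avg n f = avg n g.
Proof.
by move=> fg; congr (_ / _); apply: eq_bigr => q _; rewrite fg // plateaux_le.
Qed.

Lemma avgD f g : avg n (fun k => f k + g k) = avg n f + avg n g.
Proof. by rewrite /avg big_split mulrDl. Qed.

Lemma avgZ c f : avg n (fun k => c * f k) = c * avg n f.
Proof. by rewrite /avg -mulr_sumr mulrA. Qed.

Lemma avgB f g : avg n (fun k => f k - g k) = avg n f - avg n g.
Proof. by rewrite /avg big_split /= sumrN mulrBl. Qed.

Lemma avg_cst (c : R) : avg n (fun=> c) = c.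
Proof.
rewrite /avg sumr_const -[_ *+ _]mulr_natr mulfK //.
by rewrite pnatr_eq0 -lt0n card_stirling_gt0.
Qed.

Lemma le_avg f g : (forall k, (k <= 2 * n)%N -> f k <= g k) -> avg n f <= avg n g.
Proof.
move=> fg; rewrite /avg ler_wpM2r // ?invr_ge0 //.
by apply: ler_sum => q _; rewrite fg // plateaux_le.
Qed.

Lemma ler_norm_avg f : `|avg n f| <= avg n (fun k => `|f k|).
Proof.
rewrite /avg normrM [X in _ * X]ger0_norm ?invr_ge0 // ler_wpM2r ?invr_ge0 //.
exact: ler_norm_sum.
Qed.

Lemma avgS f : avg n.+1 f = avg n (fun k => k%:R / (2 * n%:R + 1) * f k +
   (1 - k%:R / (2 * n%:R + 1)) * f k.+1).
Proof.
rewrite /avg big_stirlingS card_stirlingS natrM.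
have n0 : (2 * n%:R + 1 : R) != 0 by rewrite gt_eqF // ltr_wpDl // mulr_ge0.
have -> : (2 * n).+1%:R = 2 * n%:R + 1 :> R by rewrite -addn1 natrD natrM.
rewrite invfM mulrA; congr (_ / _).
rewrite mulr_suml; apply: eq_bigr => q _.
rewrite -[_ *+ plateaux q]mulr_natr -[_ *+ (_ - _)]mulr_natr natrB; last first.
  by have := plateaux_le q; lia.
have -> : (2 * n).+1%:R = 2 * n%:R + 1 :> R by rewrite -addn1 natrD natrM.
by field.
Qed.
End average.

(** * Expectations under the uniform law as finite averages *)

Section expectation.
Variables (R : realType) (n : nat).
Local Notation P := (stirling_unif R n).

Lemma stirling_unif_set1 (q : stirling n) :
  P [set q] = (#|{: stirling n}|%:R^-1)%:E.
Proof.
rewrite /stirling_unif /mscale /= /counting asboolT //= fset_set1 cardfs1.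
by rewrite mule1.
Qed.

Lemma stirling_unif_expectation (g : stirling n -> R) :
  'E_P[g]%E = ((\sum_q g q) / #|{: stirling n}|%:R)%:E.
Proof.
rewrite unlock.
(* A function on a finite type is a finite combination of indicators of singletons, which can be
   integrated term by term. *)
have gE x : ((g x)%:E = \sum_(q : stirling n) (g q)%:E * (\1_[set q] x)%:E)%E.
  under eq_bigr do rewrite -EFinM.
  rewrite sumEFin (bigD1 x) //= indicE mem_set // mulr1 big1 ?addr0 // => q qx.
  by rewrite indicE memNset ?mulr0 //= => E; rewrite E eqxx in qx.
under eq_integral do rewrite gE.
rewrite integral_sum //=; last first.
  move=> q; apply: integrableZl => //; exact: integrable_indic.
rewrite mulr_suml -sumEFin; apply: eq_bigr => q _.
rewrite integralZl //; last exact: integrable_indic.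
by rewrite integral_indic // setIT EFinM; congr (_ * _)%E; exact: stirling_unif_set1.
Qed.

Lemma expectation_plateaux (g : nat -> R) :
  'E_P[fun q => g (plateaux q)]%E = (avg n g)%:E.
Proof. exact: stirling_unif_expectation. Qed.
End expectation.

(** * The Gaussian solution of the heat equation *)

Section mean_value.
Variable R : realType.
Implicit Types (f df : R -> R) (a b x K : R).

Lemma MVT_le f df a b : a <= b ->
  (forall x, a <= x <= b -> is_derive x 1 f (df x)) ->
  exists2 c, a <= c <= b & f b - f a = df c * (b - a).
Proof.
move=> ab fdf.
have [] := @MVT_segment R f df a b ab.
- by move=> x xab; apply: fdf; rewrite !ltW ?(itvP xab).
- apply: derivable_within_continuous => x; rewrite in_itv /= => xab.
  by have := fdf x xab => ?; exact: ex_derive.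
- by move=> c cab ->; exists c => //; rewrite !(itvP cab).
Qed.

Lemma MVT_between f df a b : (forall x, is_derive x 1 f (df x)) ->
  exists2 c, `|c - a| <= `|b - a| & f b - f a = df c * (b - a).
Proof.
move=> fdf; have [ab|/ltW ba] := leP a b.
  have [c /andP[ac cb] ->] := MVT_le ab (fun x _ => fdf x).
  by exists c => //; rewrite !ger0_norm; lra.
have [c /andP[ac cb] E] := MVT_le ba (fun x _ => fdf x).
exists c; first by rewrite !ler0_norm; lra.
by rewrite -opprB E -mulrN opprB.
Qed.

Lemma derive_lipschitz f df K : (forall x, is_derive x 1 f (df x)) ->
  (forall x, `|df x| <= K) -> forall a b, `|f b - f a| <= K * `|b - a|.
Proof.
move=> fdf dfK a b; have [c _ ->] := MVT_between a b fdf.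
by rewrite normrM ler_wpM2r.
Qed.

(** Two mean value steps on the remainder, seen as a function of the endpoint, followed by a
    Lipschitz bound on [f2]. This yields [K] rather than the sharp [K / 6], which is enough here. *)
Lemma taylor2_le f f1 f2 f3 K : (forall x, is_derive x 1 f (f1 x)) ->
  (forall x, is_derive x 1 f1 (f2 x)) -> (forall x, is_derive x 1 f2 (f3 x)) ->
  (forall x, `|f3 x| <= K) -> forall x d,
  `|f (x + d) - f x - f1 x * d - f2 x / 2 * d ^+ 2| <= K * `|d| ^+ 3.
Proof.
move=> ff1 f1f2 f2f3 f3K x d.
pose g t := f t - f1 x * (t - x) - f2 x / 2 * (t - x) ^+ 2.
pose g1 t := f1 t - f1 x - f2 x * (t - x).
have gg1 (t : R) : is_derive t 1 g (g1 t).
  rewrite /g; have -> : g1 t = f1 t - f1 x * (1 - 0) - f2 x / 2 * (2 * (t - x) * (1 - 0)).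
    by rewrite /g1; field.
  have ? := ff1 t; apply: is_derive_eq.
  by rewrite /GRing.scale /=; field.
have g12 (t : R) : is_derive t 1 g1 (f2 t - f2 x).
  rewrite /g1; have ? := f1f2 t; apply: is_derive_eq.
  by rewrite /GRing.scale /=; field.
have [c cd E] := MVT_between x (x + d) gg1.
have [c' cd' E'] := MVT_between x c g12.
have -> : f (x + d) - f x - f1 x * d - f2 x / 2 * d ^+ 2 = g (x + d) - g x.
  by rewrite /g; field.
have xd : x + d - x = d by rewrite addrC addKr.
have g1x : g1 x = 0 by rewrite /g1 !subrr mulr0 subrr.
have K0 : 0 <= K := le_trans (normr_ge0 _) (f3K x).
rewrite E; rewrite g1x subr0 in E'; rewrite E' !normrM xd.
rewrite xd in cd.
have := derive_lipschitz f2f3 f3K x c' => L.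
have {}L : `|f2 c' - f2 x| <= K * `|d|.
  by apply: le_trans L _; rewrite ler_wpM2l // (le_trans cd').
rewrite !exprS expr0 mulr1 !mulrA ler_wpM2r // ler_pM //.
Qed.
End mean_value.

(** * Gaussian density, distribution function and heat flow *)

Section gauss.
Variable R : realType.
Implicit Types x r u v : R.

Definition phi x : R := normal_pdf 0 1 x.
Definition Phi x : R := fine (normal_prob (0 : R) 1 `]-oo, x]).

Lemma phiE x : phi x = normal_peak 1 * expR (- (x ^+ 2 / 2)).
Proof.
by rewrite /phi normal_pdfE ?oner_neq0 // /normal_fun subr0 expr1n mulNr.
Qed.

Lemma normal_peak1_le1 : normal_peak 1 <= 1 :> R.
Proof.
rewrite /normal_peak invf_le1; last by rewrite sqrtr_gt0 expr1n mul1r mulrn_wgt0 // pi_gt0.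
rewrite -[leLHS]sqrtr1 ler_sqrt; rewrite expr1n mul1r; have := pi_ge2 R; lra.
Qed.

Lemma phi_ge0 x : 0 <= phi x. Proof. exact: normal_pdf_ge0. Qed.

(** With t = x ^ 2 / 2, exp t >= (1 + t / 2) ^ 2 dominates 1 + 4 t ^ 2 up to the factor 16. Degree 4
    covers the polynomials in the derivatives of [heat], which have degree at most 3. *)
Lemma expr_phi_le x : (1 + x ^+ 4) * phi x <= 16.
Proof.
have e0 := expR_gt0 (x ^+ 2 / 2).
have : 1 + x ^+ 4 <= 16 * expR (x ^+ 2 / 2).
  set t := x ^+ 2 / 2; have -> : x ^+ 4 = 4 * t ^+ 2 by rewrite /t; field.
  have t0 : 0 <= t by rewrite divr_ge0 // sqr_ge0.
  have -> : t = t / 2 + t / 2 by field.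
  have := expR_ge1Dx (t / 2); rewrite expRD; set e := expR _ => te.
  nra.
move=> H; rewrite phiE expRN mulrCA -[leRHS]mul1r.
apply: ler_pM.
- exact: normal_peak_ge0.
- by rewrite mulr_ge0 ?invr_ge0 ?ltW // ltr_wpDr // (_ : 4%N = (2 * 2)%N) // exprM sqr_ge0.
- exact: normal_peak1_le1.
- by rewrite ler_pdivrMr.
Qed.

Lemma poly_phi_le (p : R -> R) (c : R) x : `|p x| <= c * (1 + x ^+ 4) ->
  0 <= c -> `|p x * phi x| <= 16 * c.
Proof.
move=> pc c0; rewrite normrM (ger0_norm (phi_ge0 x)).
apply: le_trans (ler_wpM2r (phi_ge0 x) pc) _.
by rewrite -mulrA [leRHS]mulrC ler_wpM2l // expr_phi_le.
Qed.

Lemma is_derive_Phi x : is_derive x 1 Phi (phi x).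
Proof.
have [] := @continuous_FTC1 R phi -oo%O x (x + 1).
- by rewrite ltrDl.
- apply: (@integrableS _ _ _ _ setT) => //.
  exact: integrable_normal_pdf.
- by rewrite ltNyr.
- exact: continuous_normal_pdf (oner_neq0 _) _.
move=> D E; rewrite -E derive1E.
exact: DeriveDef D erefl.
Qed.

Lemma is_derive_phi x : is_derive x 1 phi (- (x * phi x)).
Proof.
rewrite (_ : phi = fun x => normal_peak 1 * expR (- (x ^+ 2 / 2))); last first.
  by apply/funext => y; rewrite phiE.
apply: is_derive_eq.
rewrite /GRing.scale /=.
by field.
Qed.

(** For [v > 0], the distribution function at [u] of a centred normal variable of variance [v]. *)
Definition heat u v : R := Phi (u / Num.sqrt v).
(* In terms of r = u / sqrt v, these are the u-derivatives of heat of orders 1 to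
   3, and heat2v is the v-derivative of heat2. *)
Definition heat1 u v : R := phi (u / Num.sqrt v) / Num.sqrt v.
Definition heat2 u v : R :=
  - (u / Num.sqrt v) * phi (u / Num.sqrt v) / v.
Definition heat3 u v : R :=
  ((u / Num.sqrt v) ^+ 2 - 1) * phi (u / Num.sqrt v) / (v * Num.sqrt v).
Definition heat2v u v : R :=
  (3 * (u / Num.sqrt v) - (u / Num.sqrt v) ^+ 3) / 2 *
  phi (u / Num.sqrt v) / v ^+ 2.

Section heat_derivatives.
Variables (u v : R).
Hypothesis v0 : 0 < v.

Let s0 : Num.sqrt v != 0. Proof. by rewrite gt_eqF // sqrtr_gt0. Qed.
Let vE : v = Num.sqrt v ^+ 2. Proof. by rewrite sqr_sqrtr // ltW. Qed.

Let is_derive_quot (x : R) : is_derive x 1 (fun u => u / Num.sqrt v) (Num.sqrt v)^-1.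
Proof.
apply: is_derive_eq.
by rewrite /GRing.scale /= ?(mulr0, add0r, addr0, mulr1).
Qed.

Let is_derive_comp_quot (f : R -> R) l : is_derive (u / Num.sqrt v) 1 f l ->
  is_derive u 1 (fun u => f (u / Num.sqrt v)) (l / Num.sqrt v).
Proof.
move=> fl; have ? := is_derive_quot u.
exact: (@is_derive1_comp _ f (fun u => u / Num.sqrt v)).
Qed.

Lemma is_derive_heat : is_derive u 1 (heat^~ v) (heat1 u v).
Proof. exact: is_derive_comp_quot (is_derive_Phi _). Qed.

Lemma is_derive_heat1 : is_derive u 1 (heat1^~ v) (heat2 u v).
Proof.
have ? := is_derive_comp_quot (is_derive_phi _).
rewrite /heat1; apply: is_derive_eq; rewrite /heat2 /GRing.scale /=.
by move: s0 vE; set s := Num.sqrt v => sn0 vs; rewrite vs; field.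
Qed.

Lemma is_derive_heat2 : is_derive u 1 (heat2^~ v) (heat3 u v).
Proof.
have ? := is_derive_comp_quot (is_derive_phi _).
have ? := is_derive_quot u.
rewrite /heat2; apply: is_derive_eq; rewrite /heat3 /GRing.scale /=.
by move: s0 vE; set s := Num.sqrt v => sn0 vs; rewrite vs; field.
Qed.

Let is_derive_quotv : is_derive v 1 (fun v => u / Num.sqrt v) (- (u / Num.sqrt v / (2 * v))).
Proof.
have ? := is_derive1_sqrt v0.
have ? := is_deriveV s0 (is_derive1_sqrt v0).
apply: is_derive_eq; rewrite /GRing.scale /=.
by move: s0 vE; set s := Num.sqrt v => sn0 vs; rewrite vs; field.
Qed.

Let is_derive_comp_quotv (f : R -> R) l : is_derive (u / Num.sqrt v) 1 f l ->
  is_derive v 1 (fun v => f (u / Num.sqrt v)) (l * - (u / Num.sqrt v / (2 * v))).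
Proof.
move=> fl; have ? := is_derive_quotv.
exact: (@is_derive1_comp _ f (fun v => u / Num.sqrt v)).
Qed.

(** The heat equation: lowering [v] by [w] offsets, to leading order, the second-order effect of a
    random displacement of variance [w]. *)
Lemma is_derive_heatv : is_derive v 1 (heat u) (heat2 u v / 2).
Proof.
have ? := is_derive_comp_quotv (is_derive_Phi _).
rewrite /heat; apply: is_derive_eq; rewrite /heat2.
by field; rewrite gt_eqF.
Qed.

Lemma is_derive_heat2v : is_derive v 1 (heat2 u) (heat2v u v).
Proof.
have ? := is_derive_comp_quotv (is_derive_phi _).
have ? := is_derive_quotv.
have vn0 : v != 0 by rewrite gt_eqF.
have ? := is_deriveV vn0 (is_derive_id _ _).
rewrite /heat2; apply: is_derive_eq; rewrite /heat2v /GRing.scale /=.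
by field; rewrite ?vn0 ?s0.
Qed.
End heat_derivatives.

(** * Uniform derivative bounds and the expansion of [heat] *)

Section heat_bounds.
Variables (e : R).
Hypotheses (e0 : 0 < e) (e1 : e <= 1).
(** The numerator is 16 times the largest constant, 2, given to [poly_phi_le]. As [e <= 1], the
    denominators [v], [v * Num.sqrt v] and [v ^+ 2] are all at least [e ^+ 2] once [e <= v]. *)
Let K := 32 / e ^+ 2.

Let le_div (a c : R) : `|a| <= 32 -> e ^+ 2 <= c -> `|a / c| <= K.
Proof.
move=> a32 ec; have c0 : 0 < c := lt_le_trans (exprn_gt0 2 e0) ec.
rewrite normrM normfV (ger0_norm (ltW c0)) /K ler_pM ?invr_ge0 //; first exact: ltW.
by rewrite lef_pV2 // posrE exprn_gt0.
Qed.

Let norm_le_half (r : R) : `|r| <= (1 + r ^+ 2) / 2.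
Proof. by have := sqr_ge0 (`|r| - 1); rewrite sqrrB -normrX (ger0_norm (sqr_ge0 r)); lra. Qed.

Let le_pow (v : R) : e <= v -> e ^+ 2 <= v.
Proof. by move=> ev; apply: le_trans ev; rewrite expr2 ger_pMl. Qed.

Lemma heat2_le u v : e <= v -> `|heat2 u v| <= K.
Proof.
move=> ev; apply: le_div; last exact: le_pow.
set r := u / _; rewrite (_ : - r * phi r = (fun r => - r) r * phi r) //.
apply: le_trans (@poly_phi_le -%R 1 r _ _) _; [|lra|lra].
rewrite normrN mul1r.
have := norm_le_half r; have := norm_le_half (r ^+ 2).
rewrite (ger0_norm (sqr_ge0 r)) (_ : r ^+ 4 = (r ^+ 2) ^+ 2) -?exprM //.
by have := sqr_ge0 (r ^+ 2); rewrite -exprM; lra.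
Qed.

Lemma heat3_le u v : e <= v -> `|heat3 u v| <= K.
Proof.
move=> ev; apply: le_div; last first.
  have ev2 : e <= Num.sqrt v.
    rewrite -[leLHS](ger0_norm (ltW e0)) -sqrtr_sqr.
    exact: ler_wsqrtr (le_pow ev).
  by rewrite (expr2 e); apply: ler_pM => //; exact: ltW.
set r := u / _.
apply: le_trans (@poly_phi_le (fun r => r ^+ 2 - 1) 2 r _ _) _; [|lra|lra].
have := sqr_ge0 r; rewrite (_ : r ^+ 4 = (r ^+ 2) ^+ 2); last by rewrite -exprM.
by move: (r ^+ 2) => s s0; rewrite ler_norml; nra.
Qed.

Lemma heat2v_le u v : e <= v -> `|heat2v u v| <= K.
Proof.
move=> ev; apply: le_div; last by rewrite lerXn2r // nnegrE ltW // (lt_le_trans e0).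
set r := u / _.
apply: le_trans (@poly_phi_le (fun r => (3 * r - r ^+ 3) / 2) 2 r _ _) _; [|lra|lra].
have -> : r ^+ 3 = r * r ^+ 2 by rewrite exprS.
have -> : r ^+ 4 = (r ^+ 2) ^+ 2 by rewrite -exprM.
have := norm_le_half r.
have := sqr_ge0 r; move: (r ^+ 2) => s s0.
move=> rs; rewrite (_ : (3 * r - r * s) / 2 = r * ((3 - s) / 2)); last by field.
have s3 : `|(3 - s) / 2| <= (3 + s) / 2 by rewrite ler_norml; lra.
rewrite normrM; apply: le_trans (ler_pM (normr_ge0 _) (normr_ge0 _) rs s3) _.
by have := sqr_ge0 (s - 1); nra.
Qed.

(** The subtracted terms are those that vanish on average when [d] has mean 0 and variance [w]. The
    change in space is expanded by Taylor at fixed [v]; the change in [v] is converted by the heat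
    equation into a second space derivative. *)
Lemma heat_step u v d w : e <= v - w -> 0 <= w ->
  `|heat (u + d) (v - w) - heat u v - heat1 u v * d - heat2 u v / 2 * (d ^+ 2 - w)|
  <= K * (`|d| ^+ 3 + w * `|d| + w ^+ 2).
Proof.
move=> evw w0; have ev : e <= v by lra.
have e0' := e0; have v0 : 0 < v by lra.
have K0 : 0 <= K by rewrite divr_ge0 // exprn_ge0 // ltW.
have T1 := taylor2_le (fun x => is_derive_heat x v0) (fun x => is_derive_heat1 x v0)
  (fun x => is_derive_heat2 x v0) (fun x => heat3_le x ev) u d.
have [|z|c /andP[c1 c2] T2] := @MVT_le R (heat (u + d)) (fun z => heat2 (u + d) z / 2) (v - w) v.
- lra.
- by move=> /andP[z1 _]; apply: is_derive_heatv; lra.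
have [|z|c' /andP[c1' c2'] T3] := @MVT_le R (heat2 (u + d)) (heat2v (u + d)) c v.
- lra.
- by move=> /andP[z1 _]; apply: is_derive_heat2v; lra.
have T4 : `|heat2 (u + d) v - heat2 u v| <= K * `|d|.
  have := derive_lipschitz (fun x => is_derive_heat2 x v0) (fun x => heat3_le x ev) u (u + d).
  by rewrite (_ : u + d - u = d) //; ring.
have T5 : `|heat2 (u + d) v - heat2 (u + d) c| <= K * w.
  rewrite T3 normrM ler_pM //; first by apply: heat2v_le; lra.
  by rewrite ger0_norm; lra.
have -> : heat (u + d) (v - w) - heat u v - heat1 u v * d - heat2 u v / 2 * (d ^+ 2 - w) =
  (heat (u + d) v - heat u v - heat1 u v * d - heat2 u v / 2 * d ^+ 2) -
  ((heat (u + d) v - heat (u + d) (v - w)) - heat2 u v / 2 * w) by ring.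
rewrite T2 (_ : v - (v - w) = w); last by ring.
apply: le_trans (ler_normB _ _) _.
rewrite -(addrA (`|d| ^+ 3)) mulrDr; apply: lerD => //.
(* The second derivative at [(u + d, c)] is compared with that at [(u, v)] through [(u + d, v)]:
   [T4] covers the move in space, [T5] the move in variance. *)
rewrite [X in `|X|](_ : _ =
  ((heat2 (u + d) v - heat2 u v) - (heat2 (u + d) v - heat2 (u + d) c)) * (w / 2)); last by field.
rewrite normrM (ger0_norm (_ : 0 <= w / 2)); last lra.
have T6 := le_trans (ler_normB _ _) (lerD T4 T5).
apply: le_trans (ler_wpM2r (_ : 0 <= w / 2) T6) _; first lra.
have p1 : 0 <= K * w * w by apply: mulr_ge0 => //; apply: mulr_ge0.
have p2 : 0 <= K * `|d| * w by apply: mulr_ge0 => //; apply: mulr_ge0.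
by move: p1 p2; move: (`|d|) K => dd k; nra.
Qed.
End heat_bounds.
End gauss.

(** * Monotonicity, Lipschitz bound and tails of [Phi] *)

Section normal_cdf.
Variable R : realType.
Implicit Types x y : R.

Lemma EFin_Phi x : (Phi x)%:E = normal_prob (0 : R) 1 `]-oo, x].
Proof. by rewrite fineK // fin_num_measure. Qed.

Lemma Phi_ge0 x : 0 <= Phi x.
Proof. by rewrite -lee_fin EFin_Phi. Qed.

Lemma Phi_le1 x : Phi x <= 1.
Proof. by rewrite -lee_fin EFin_Phi probability_le1. Qed.

(** The identity is a random variable with distribution function [Phi], so general facts on [cdf]
    give monotonicity and the limits at infinity. *)
Let idR : measurableTypeR R -> R := idfun.

#[local] HB.instance Definition _ :=
  @isMeasurableFun.Build _ _ _ _ idR (@measurable_id _ _ setT).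

Let X : {RV (normal_prob (0 : R) 1) >-> R} := idR.

Let cdfE : cdf X = EFin \o @Phi R.
Proof. by apply/funext => x; rewrite /= EFin_Phi. Qed.

Lemma le_Phi x y : x <= y -> Phi x <= Phi y.
Proof.
by move=> /(cdf_nondecreasing X); rewrite cdfE lee_fin.
Qed.

Lemma phi_le1 x : phi x <= 1.
Proof.
exact: le_trans (normal_pdf_ub _ _ (oner_neq0 _)) (normal_peak1_le1 _).
Qed.

Lemma Phi_lipschitz x y : `|Phi y - Phi x| <= `|y - x|.
Proof.
rewrite -[leRHS]mul1r; apply: (derive_lipschitz (@is_derive_Phi R)) => z.
by rewrite ger0_norm ?phi_ge0 // phi_le1.
Qed.

Lemma Phi_tails (eta : R) : 0 < eta ->
  exists2 M, 0 < M & 1 - eta <= Phi M /\ Phi (- M) <= eta.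
Proof.
move=> eta0.
have cy : Phi x @[x --> +oo] --> (1 : R).
  have := @cvg_cdfy1 _ _ _ _ X; rewrite cdfE.
  by move/fine_cvg.
have cNy : Phi x @[x --> -oo] --> (0 : R).
  have := @cvg_cdfNy0 _ _ _ _ X; rewrite cdfE.
  by move/fine_cvg.
move/cvgrPdist_le/(_ _ eta0): cy => [A [_ HA]].
move/cvgrPdist_le/(_ _ eta0): cNy => [B [_ HB]].
pose M := Num.max 1 (Num.max (A + 1) (1 - B)).
exists M; first by rewrite /M lt_max ltr01.
have MA : A < M by rewrite /M !lt_max (_ : A < A + 1) ?orbT //; lra.
have MB : - M < B.
  have : 1 - B <= M by rewrite /M !le_max lexx !orbT.
  lra.
split.
  by have := HA _ MA; rewrite ler_norml => /andP[_]; lra.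
by have := HB _ MB; rewrite sub0r normrN ler_norml => /andP[_].
Qed.

End normal_cdf.

(** * The Lindeberg argument *)

Section moments.
Variable R : realType.
Implicit Types (n k : nat) (s : R).

(** The centring and the formula for [var] are those of the chain only from [n = 1] on: at [n = 0]
    they give 1 / 3 and 2 / 9, while the empty word has no plateau. *)
Definition dev n k : R := k%:R - (2 * n%:R + 1) / 3.
Definition var n : R := 2 * (n%:R ^+ 2 - 1) / (9 * (2 * n%:R - 1)).

Lemma avg1 (f : nat -> R) : avg 1 f = f 1%N.
Proof.
rewrite avgS -[RHS](avg_cst 0); apply: eq_avg => k.
by rewrite muln0 leqn0 => /eqP ->; rewrite !mul0r subr0 add0r mul1r.
Qed.

Lemma avg_dev n : (0 < n)%N -> avg n (dev n) = 0.
Proof.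
case: n => // n _; elim: n => [|n IH].
  by rewrite avg1 /dev; field.
(* Given the present state, one step multiplies the expected deviation by 2 m / (2 m + 1), where m =
   [n.+1]; [growth] later undoes this factor. *)
rewrite avgS (eq_avg (g := fun k => 2 * n.+1%:R / (2 * n.+1%:R + 1) * dev n.+1 k)).
  by rewrite avgZ IH mulr0.
move=> k _; rewrite /dev -[k.+1]addn1 -[n.+2]addn1 !natrD.
by field; rewrite gt_eqF // ltr_wpDl // mulr_ge0.
Qed.

Lemma avg_dev_sqr n : (0 < n)%N -> avg n (fun k => dev n k ^+ 2) = var n.
Proof.
case: n => // n _; elim: n => [|n IH].
  by rewrite avg1 /dev /var expr1n subrr mulr0 mul0r; field.
set r : R := n.+1%:R; have r1 : 1 <= r by rewrite ler1n.
(* The conditional second moment of the next deviation, computed with staying probability 1 / 3 +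
   dev / (2 r + 1). *)
rewrite avgS (eq_avg (g := fun k => (1 - 2 / (2 * r + 1)) * dev n.+1 k ^+ 2 +
    (3 * (2 * r + 1))^-1 * dev n.+1 k + 2 / 9)).
  rewrite !avgD !avgZ IH avg_dev // avg_cst /var -[n.+2]addn1 natrD -/r.
  by field; rewrite !gt_eqF //; lra.
move=> k _; rewrite /dev -[k.+1]addn1 -[n.+2]addn1 !natrD -/r.
by field; rewrite !gt_eqF //; lra.
Qed.

Lemma var_le n : (0 < n)%N -> var n <= n%:R.
Proof.
rewrite -(ler1n R) /var; move: n%:R => r r1.
by rewrite ler_pdivrMr; nra.
Qed.

Lemma var_ge0 n : (0 < n)%N -> 0 <= var n.
Proof.
rewrite -(ler1n R) /var; move: n%:R => r r1.
by rewrite divr_ge0; nra.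
Qed.

Lemma var_ge n : (1 < n)%N -> n%:R / 12 <= var n.
Proof.
rewrite -(ler_nat R) /var; move: n%:R => r r1.
by rewrite ler_pdivlMr; nra.
Qed.

(** Both sides are the mean conditional variance of a step, the average of p (1 - p) for p = 1 / 3 +
    dev / (2 n + 1). *)
Lemma varS n : (0 < n)%N ->
  var n.+1 - (2 * n%:R / (2 * n%:R + 1)) ^+ 2 * var n =
  2 / 9 - var n / (2 * n%:R + 1) ^+ 2.
Proof.
rewrite -(ler1n R) /var -[n.+1]addn1 natrD; move: n%:R => r r1.
by field; rewrite !gt_eqF //; lra.
Qed.

Lemma var_div_le n : (0 < n)%N -> var n / (2 * n%:R + 1) ^+ 2 <= 2 / 9.
Proof.
move=> n0; have := var_le n0; move: n0; rewrite -(ler1n R).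
move: (n%:R) (var n) => r v r1 vr.
by rewrite ler_pdivrMr ?exprn_gt0; nra.
Qed.

(* AM-GM, so that first absolute moments are bounded by the variance. *)
Lemma norm_dev_le n k s : 0 < s -> `|dev n k| <= s / 2 + dev n k ^+ 2 / (2 * s).
Proof.
move=> s0; have := sqr_ge0 (`|dev n k| - s).
rewrite sqrrB -normrX (ger0_norm (sqr_ge0 (dev n k))); set a := `|_| => H.
have -> : s / 2 + dev n k ^+ 2 / (2 * s) = (dev n k ^+ 2 + s ^+ 2) / (2 * s).
  by field; rewrite gt_eqF.
by rewrite ler_pdivlMr; lra.
Qed.

(** Leaving [s] free allows the single choice [Num.sqrt N%:R] for all times [n] up to [N]. *)
Lemma avg_norm_dev_le n s : (0 < n)%N -> 0 < s -> n%:R <= s ^+ 2 ->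
  avg n (fun k => `|dev n k|) <= s.
Proof.
move=> n0 s0 ns.
have := @le_avg R n _ _ (fun k _ => norm_dev_le n k s0).
rewrite avgD avg_cst (eq_avg (f := fun k => dev n k ^+ 2 / (2 * s))
    (g := fun k => (2 * s)^-1 * dev n k ^+ 2)); last first.
  by move=> k _; rewrite mulrC.
rewrite avgZ avg_dev_sqr // => /le_trans; apply.
have := var_le n0 => vn.
have : (2 * s)^-1 * var n <= (2 * s)^-1 * s ^+ 2.
  by rewrite ler_wpM2l ?invr_ge0; lra.
have -> : (2 * s)^-1 * s ^+ 2 = s / 2 by field; rewrite gt_eqF.
lra.
Qed.

(* growth n is proportional to the factor that turns dev n into a martingale. *)
Definition growth n : R := \prod_(1 <= m < n) ((2 * m%:R + 1) / (2 * m%:R)).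

Lemma growth_gt0 n : 0 < growth n.
Proof.
rewrite /growth big_seq; apply: prodr_gt0 => m; rewrite mem_index_iota => /andP[m1 _].
move: m1; rewrite -(ler1n R) => m1.
by rewrite divr_gt0; lra.
Qed.

Lemma growthS n : (0 < n)%N -> growth n = growth n.+1 * (2 * n%:R / (2 * n%:R + 1)).
Proof.
move=> n0; rewrite /growth big_nat_recr //=; move: (\prod_(1 <= m < n) _) => p.
by move: n0; rewrite -(ler1n R) => n1; field; rewrite !gt_eqF //; lra.
Qed.

(** The ratio [growth n ^+ 2 / n%:R] is nondecreasing, because (1 + 1 / (2 m)) ^ 2 >= 1 + 1 / m. *)
Lemma growth_sqr_le n N : (0 < n <= N)%N ->
  growth n ^+ 2 * N%:R <= growth N ^+ 2 * n%:R.
Proof.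
move=> /andP[n0 nN].
have n0R : 0 < n%:R :> R by rewrite ltr0n.
have N0R : 0 < N%:R :> R by rewrite ltr0n (leq_trans n0).
suff : growth n ^+ 2 / n%:R <= growth N ^+ 2 / N%:R.
  by rewrite ler_pdivrMr // mulrAC ler_pdivlMr.
case: n n0 nN {n0R} => // n _; case: N N0R => // N _; rewrite ltnS.
move: n N; apply: (@homo_leq _ (fun m => growth m.+1 ^+ 2 / m.+1%:R) <=%R).
- by move=> x.
- by move=> y x z; exact: le_trans.
move=> m; rewrite (growthS (ltn0Sn m)) -[m.+2]addn1 natrD.
have : 1 <= m.+1%:R :> R by rewrite ler1n.
move: (m.+1%:R) (growth _) => r g r1.
have -> : (g * (2 * r / (2 * r + 1))) ^+ 2 / r = g ^+ 2 * (4 * r / (2 * r + 1) ^+ 2).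
  by field; rewrite !gt_eqF //; lra.
rewrite ler_wpM2l ?sqr_ge0 // ler_pdivrMr; last by rewrite exprn_gt0; lra.
by rewrite [leRHS]mulrC ler_pdivlMr; nra.
Qed.
End moments.

(** * One step of the chain as a two-point increment *)

Section two_point.
Variable R : realType.
Implicit Types e p c z V l w y v : R.

(* The exact second-order expansion of a mean-zero two-point increment: it takes
   the values c (1 - p) and - c p with probabilities p and 1 - p. *)
Lemma two_point_identity p c z V l w h0 h1 a0 a1 a2 :
  l != 0 -> p = 1 / 3 + z / l -> w = c ^+ 2 * (2 / 9 - V / l ^+ 2) ->
  p * h0 + (1 - p) * h1 - a0 =
  p * (h0 - a0 - a1 * (c * (1 - p)) - a2 / 2 * ((c * (1 - p)) ^+ 2 - w)) +
  (1 - p) * (h1 - a0 - a1 * - (c * p) - a2 / 2 * ((- (c * p)) ^+ 2 - w)) +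
  a2 / 2 * (c ^+ 2 / l * (z / 3 + (V - z ^+ 2) / l)).
Proof.
move=> l0 pE wE.
have -> : c ^+ 2 / l * (z / 3 + (V - z ^+ 2) / l) = c ^+ 2 * (p * (1 - p)) - w.
  by rewrite pE wE; field.
by ring.
Qed.

(** The decrement [w] is built from the mean of p (1 - p), not from its value at the present state,
    so that [v] stays deterministic. The last term of the bound pays for this discrepancy. *)
Lemma two_point_step e p c z V l w y v (K := 32 / e ^+ 2) :
  0 < e -> e <= 1 -> 0 < c -> 0 <= p -> p <= 1 -> 0 < l -> 0 <= V ->
  p = 1 / 3 + z / l -> w = c ^+ 2 * (2 / 9 - V / l ^+ 2) -> 0 <= w ->
  e <= v - w ->
  `|p * heat (y + c * (1 - p)) (v - w) + (1 - p) * heat (y + - (c * p)) (v - w)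
    - heat y v| <=
  K * (2 * c ^+ 3 + c ^+ 4) +
  K / 2 * (c ^+ 2 / l * (`|z| / 3 + (z ^+ 2 + V) / l)).
Proof.
move=> e0 e1 c0 p0 p1 l0 V0 pE wE w0 vw.
have K0 : 0 <= K by rewrite divr_ge0 // exprn_ge0 // ltW.
have Vl : 0 <= V / l ^+ 2 by rewrite divr_ge0 // sqr_ge0.
have wc : w <= c ^+ 2 by rewrite wE ler_piMr ?sqr_ge0 //; lra.
have step d : `|d| <= c -> `|heat (y + d) (v - w) - heat y v - heat1 y v * d -
    heat2 y v / 2 * (d ^+ 2 - w)| <= K * (2 * c ^+ 3 + c ^+ 4).
  move=> dc; apply: le_trans (heat_step e0 e1 y d vw w0) _.
  apply: ler_wpM2l => //.
  have : `|d| ^+ 3 <= c ^+ 3 by rewrite lerXn2r // nnegrE // ltW.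
  have : w * `|d| <= c ^+ 2 * c by rewrite ler_pM.
  have : w ^+ 2 <= (c ^+ 2) ^+ 2 by rewrite lerXn2r // nnegrE // sqr_ge0.
  by rewrite -exprM -exprSr; lra.
have norm_le_mul q : 0 <= q -> q <= 1 -> `|c * q| <= c.
  by move=> q0 q1; rewrite ger0_norm; [rewrite ler_piMr // ltW|rewrite mulr_ge0 // ltW].
have q0 : 0 <= 1 - p by lra.
have q1 : 1 - p <= 1 by lra.
have T0 := step _ (norm_le_mul _ q0 q1).
have T1 := step (- (c * p)); rewrite normrN in T1; have {}T1 := T1 (norm_le_mul _ p0 p1).
have h2 : `|heat2 y v / 2| <= K / 2.
  rewrite normrM (ger0_norm (_ : 0 <= 2^-1 :> R)) ?invr_ge0 //.
  rewrite ler_wpM2r ?invr_ge0 //.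
  by apply: heat2_le => //; lra.
rewrite (two_point_identity _ _ _ (heat1 y v) (heat2 y v) _ pE wE) ?gt_eqF //.
apply: le_trans (ler_normD _ _) (lerD _ _).
  apply: le_trans (ler_normD _ _) _.
  rewrite (normrM p) (normrM (1 - p)) (ger0_norm p0) (ger0_norm q0).
  have := ler_wpM2l p0 T0; have := ler_wpM2l q0 T1.
  by move=> H1 H2; apply: le_trans (lerD H2 H1) _; rewrite -mulrDl addrC subrK mul1r.
rewrite normrM; apply: ler_pM => //.
have cl : 0 <= c ^+ 2 / l by rewrite divr_ge0 ?sqr_ge0 // ltW.
rewrite normrM (ger0_norm cl); apply: ler_wpM2l => //.
apply: le_trans (ler_normD _ _) (lerD _ _).
  by rewrite normrM (ger0_norm (_ : 0 <= 3^-1 :> R)) ?invr_ge0.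
have l'0 : 0 <= l^-1 by rewrite invr_ge0 ltW.
rewrite normrM (ger0_norm l'0); apply: ler_wpM2r => //.
have := sqr_ge0 z => z0.
by rewrite ler_norml; apply/andP; split; lra.
Qed.
End two_point.

(** * The replacement argument between times 1 and [N] *)

Section lindeberg.
Variables (R : realType) (N : nat) (e x : R).
Hypotheses (N1 : (1 < N)%N) (e0 : 0 < e) (e1 : e <= 1).

Local Notation dev := (@dev R).
Local Notation var := (@var R).
Let K : R := 32 / e ^+ 2.

(** The martingale multiplier, normalised so that the martingale has variance 1 at time [N]. *)
Definition scale n : R := growth R n / (growth R N * Num.sqrt (var N)).
(** The second argument of [heat] is the variance still to come before time [N], plus the smoothing
    variance [e]. *)
Definition smoothed n k : R :=
  heat (x - scale n * dev n k) (1 + e - scale n ^+ 2 * var n).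

Let varN_gt0 : 0 < var N.
Proof. by apply: lt_le_trans (var_ge R N1); rewrite divr_gt0 // ltr0n ltnW. Qed.

Lemma scale_gt0 n : 0 < scale n.
Proof. by rewrite divr_gt0 ?mulr_gt0 ?growth_gt0 ?sqrtr_gt0. Qed.

Lemma scaleS n : (0 < n)%N ->
  scale n = scale n.+1 * (2 * n%:R / (2 * n%:R + 1)).
Proof. by move=> n0; rewrite /scale (growthS _ n0) mulrAC. Qed.

Lemma scaleN : scale N = (Num.sqrt (var N))^-1.
Proof. by rewrite /scale invfM mulrA divff ?mul1r // gt_eqF // growth_gt0. Qed.

Lemma scale_sqr_var_N : scale N ^+ 2 * var N = 1.
Proof.
by rewrite scaleN exprVn sqr_sqrtr ?mulVf // ?gt_eqF // ltW.
Qed.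

Lemma scale_sqr_varS n : (0 < n)%N ->
  scale n.+1 ^+ 2 * var n.+1 - scale n ^+ 2 * var n =
  scale n.+1 ^+ 2 * (2 / 9 - var n / (2 * n%:R + 1) ^+ 2).
Proof. by move=> n0; rewrite -varS // (scaleS n0); ring. Qed.

(** The variance of a martingale is nondecreasing in time. This keeps the second argument of [heat]
    at least [e], where the derivative bounds hold. *)
Lemma scale_sqr_var_le1 n : (0 < n <= N)%N -> scale n ^+ 2 * var n <= 1.
Proof.
move=> /andP[n0 nN]; rewrite -scale_sqr_var_N.
case: n n0 nN => // n _; case: N N1 => // M _; rewrite ltnS.
move: n M; apply: (@homo_leq _ (fun m => scale m.+1 ^+ 2 * var m.+1) <=%R).
- by move=> y.
- by move=> y z t; exact: le_trans.
move=> m; rewrite -subr_ge0 scale_sqr_varS // mulr_ge0 ?sqr_ge0 //.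
by rewrite subr_ge0 var_div_le.
Qed.

Lemma scale_sqr_le n : (0 < n <= N)%N -> scale n ^+ 2 <= 12 * n%:R / N%:R ^+ 2.
Proof.
move=> nN; have := growth_sqr_le R nN.
have g0 := growth_gt0 R N; have N0 : 0 < N%:R :> R by rewrite ltr0n ltnW.
have vN := var_ge R N1.
rewrite /scale expr_div_n exprMn sqr_sqrtr; last exact: ltW.
move=> H; rewrite ler_pdivrMr; last by rewrite mulr_gt0 ?exprn_gt0.
rewrite mulrAC ler_pdivlMr; last by rewrite exprn_gt0.
have : growth R N ^+ 2 * n%:R * (N%:R / 12) <= growth R N ^+ 2 * n%:R * var N.
  by rewrite ler_wpM2l // mulr_ge0 // sqr_ge0.
have : growth R n ^+ 2 * N%:R * N%:R <= growth R N ^+ 2 * n%:R * N%:R.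
  by rewrite ler_wpM2r // ltW.
by rewrite [N%:R ^+ 2]expr2; lra.
Qed.

Lemma step_pointwise n k : (0 < n < N)%N -> (k <= 2 * n)%N ->
  forall p c, p = k%:R / (2 * n%:R + 1) -> c = scale n.+1 ->
  `|p * smoothed n.+1 k + (1 - p) * smoothed n.+1 k.+1 - smoothed n k| <=
  K * (2 * c ^+ 3 + c ^+ 4) +
  K / 2 * (c ^+ 2 / (2 * n%:R + 1) *
    (`|dev n k| / 3 + (dev n k ^+ 2 + var n) / (2 * n%:R + 1))).
Proof.
move=> /andP[n0 nN] kn p c pdef cdef.
have n1 : 1 <= n%:R :> R by rewrite ler1n.
have c0 : 0 < c by rewrite cdef; exact: scale_gt0.
have K0 : 0 <= K by rewrite divr_ge0 // exprn_ge0 // ltW.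
have l0 : 0 < 2 * n%:R + 1 :> R by lra.
have kl : k%:R <= 2 * n%:R + 1 :> R.
  by rewrite -natrM natr1 ler_nat (leq_trans kn).
have p0 : 0 <= p by rewrite pdef divr_ge0 // ltW.
have p1 : p <= 1 by rewrite pdef ler_pdivrMr // mul1r.
have pE : p = 1 / 3 + dev n k / (2 * n%:R + 1).
  by rewrite pdef /dev; field; rewrite gt_eqF.
have cS : scale n = c * (1 - (2 * n%:R + 1)^-1).
  by rewrite scaleS // -cdef; field; rewrite gt_eqF.
have V0 := var_ge0 R n0.
set w := c ^+ 2 * (2 / 9 - var n / (2 * n%:R + 1) ^+ 2).
have wE : scale n.+1 ^+ 2 * var n.+1 - scale n ^+ 2 * var n = w by rewrite scale_sqr_varS // -cdef.
have w0 : 0 <= w by rewrite mulr_ge0 ?sqr_ge0 // subr_ge0 var_div_le.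
set y := x - scale n * dev n k.
set v := 1 + e - scale n ^+ 2 * var n.
have vw : e <= v - w.
  have := @scale_sqr_var_le1 n.+1; rewrite ltn0Sn nN => /(_ isT).
  by rewrite -wE /v; lra.
have vE : 1 + e - c ^+ 2 * var n.+1 = v - w by rewrite -wE /v cdef; ring.
(* Staying at [k] moves [y] up by [c * (1 - p)] and passing to [k.+1] moves it down by [c * p]: the
   mean-zero increment of [two_point_step]. *)
have E0 : x - c * dev n.+1 k = y + c * (1 - p).
  by rewrite /y cS pE /dev -[n.+1]addn1 natrD; field; rewrite gt_eqF.
have E1 : x - c * dev n.+1 k.+1 = y + - (c * p).
  by rewrite /y cS pE /dev -[n.+1]addn1 -[k.+1]addn1 !natrD; field; rewrite gt_eqF.
rewrite /smoothed -cdef vE E0 E1.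
exact: two_point_step.
Qed.

Lemma step_avg n : (0 < n < N)%N ->
  `|avg n.+1 (smoothed n.+1) - avg n (smoothed n)| <=
  248 * K / Num.sqrt N%:R ^+ 3.
Proof.
move=> nN; have /andP[n0 nN'] := nN.
have n1 : 1 <= n%:R :> R by rewrite ler1n.
have K0 : 0 <= K by rewrite divr_ge0 // exprn_ge0 // ltW.
have l0 : 0 < 2 * n%:R + 1 :> R by lra.
rewrite avgS -avgB.
apply: le_trans (ler_norm_avg _ _) _.
apply: le_trans (le_avg (fun k kn => step_pointwise nN kn erefl erefl)) _.
set c := scale n.+1; set s := Num.sqrt N%:R.
have s2 : s ^+ 2 = N%:R by rewrite sqr_sqrtr.
have s1 : 1 <= s by rewrite -[leLHS]sqrtr1 ler_wsqrtr // ler1n ltnW.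
have s0 : 0 < s by lra.
rewrite avgD avg_cst avgZ avgZ avgD.
rewrite (eq_avg (f := fun k => `|dev n k| / 3) (g := fun k => 3^-1 * `|dev n k|)); last first.
  by move=> k _; rewrite mulrC.
rewrite (eq_avg (f := fun k => _ / (2 * n%:R + 1))
    (g := fun k => (2 * n%:R + 1)^-1 * (dev n k ^+ 2 + var n))); last first.
  by move=> k _; rewrite mulrC.
rewrite !avgZ avgD avg_cst avg_dev_sqr //.
have nN2 : n%:R <= s ^+ 2 by rewrite s2 ler_nat ltnW.
have A := avg_norm_dev_le n0 s0 nN2.
have V0 := var_ge0 R n0; have V1 := var_le R n0.
have c0 : 0 < c by exact: scale_gt0.
have c2 : c ^+ 2 <= 12 * (n%:R + 1) / s ^+ 4.
  have := @scale_sqr_le n.+1; rewrite ltn0Sn nN' => /(_ isT).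
  by rewrite -s2 -exprM -(natr1 n).
have s4 : 0 < s ^+ 4 by rewrite exprn_gt0.
have c2s : c ^+ 2 <= 12 / s ^+ 2.
  apply: le_trans c2 _.
  have -> : 12 / s ^+ 2 = 12 * s ^+ 2 / s ^+ 4 by field; rewrite gt_eqF.
  rewrite ler_wpM2r ?invr_ge0 ?ler_wpM2l //; first exact: ltW.
  by rewrite s2 natr1 ler_nat.
(* The 12 in [c2s] is rounded up to 16 to get a rational square root. *)
have cs : c <= 4 / s.
  rewrite -[leLHS](ger0_norm (ltW c0)) -sqrtr_sqr.
  rewrite -[leRHS]ger0_norm; last by rewrite divr_ge0 // ltW.
  rewrite -[leRHS]sqrtr_sqr ler_wsqrtr // (expr_div_n 4 s) (le_trans c2s) //.
  by rewrite ler_wpM2r ?invr_ge0 ?sqr_ge0 //; lra.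
(* The factor [n%:R + 1] kept in [c2] cancels against [2 * n%:R + 1], so this quotient has order N ^
   (-2) uniformly in [n]. *)
have c2l : c ^+ 2 / (2 * n%:R + 1) <= 12 / s ^+ 4.
  rewrite ler_pdivrMr // (le_trans c2) //.
  rewrite [leRHS]mulrAC ler_wpM2r ?invr_ge0 ?(ltW s4) //; lra.
have VL : (2 * n%:R + 1)^-1 * (var n + var n) <= s.
  by rewrite mulrC ler_pdivrMr //; nra.
have C3 : 2 * c ^+ 3 + c ^+ 4 <= 240 / s ^+ 3.
  have : c ^+ 3 <= 12 / s ^+ 2 * (4 / s).
    by rewrite exprSr; apply: ler_pM => //; [exact: sqr_ge0|exact: ltW].
  have : c ^+ 4 <= 12 / s ^+ 2 * (12 / s ^+ 2).
    by rewrite (exprD c 2 2); apply: ler_pM => //; exact: sqr_ge0.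
  have -> : 12 / s ^+ 2 * (4 / s) = 48 / s ^+ 3 by field; rewrite gt_eqF.
  have -> : 12 / s ^+ 2 * (12 / s ^+ 2) = 144 / s ^+ 4 by field; rewrite gt_eqF.
  have : 144 / s ^+ 4 <= 144 / s ^+ 3.
    by rewrite ler_wpM2l // lef_pV2 ?posrE ?exprn_gt0 // ler_weXn2l.
  lra.
have T : 3^-1 * avg n (fun k => `|dev n k|) + (2 * n%:R + 1)^-1 * (var n + var n) <= 4 / 3 * s.
  by lra.
(* The constant is 248 = 240 + 8: 240 from [C3], and 8 from (1 / 2) 12 (4 / 3) in the variance
   correction. *)
apply: le_trans (lerD (ler_wpM2l K0 C3) (ler_wpM2l _ (ler_pM _ _ c2l T))) _.
- by rewrite divr_ge0.
- by rewrite divr_ge0 ?sqr_ge0 // ltW.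
- rewrite addr_ge0 // mulr_ge0 ?invr_ge0 ?addr_ge0 ?(ltW l0) //.
  by rewrite -(avg_cst n (0 : R)); apply: le_avg.
rewrite le_eqVlt; apply/orP; left; apply/eqP.
by field; rewrite gt_eqF.
Qed.

(** Telescoping: at time 1 the deviation and the variance vanish, so the average is
    [heat x (1 + e)], and fewer than [N] steps of order N ^ (-3/2) follow. *)
Lemma avg_smoothed_close :
  `|avg N (smoothed N) - heat x (1 + e)| <= 248 * K / Num.sqrt N%:R.
Proof.
have K0 : 0 <= K by rewrite divr_ge0 // exprn_ge0 // ltW.
have s0 : 0 < Num.sqrt N%:R :> R by rewrite sqrtr_gt0 ltr0n ltnW.
have -> : heat x (1 + e) = avg 1 (smoothed 1).
  have d0 : dev 1 1 = 0 by rewrite /dev; field.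
  have v0 : var 1 = 0 by rewrite /var expr1n subrr mulr0 mul0r.
  by rewrite avg1 /smoothed d0 v0 !mulr0 !subr0.
rewrite -(telescope_sumr (fun n => avg n (smoothed n)) (ltnW N1)).
apply: le_trans (ler_norm_sum _ _ _) _.
apply: (@le_trans _ _ (\sum_(1 <= n < N) 248 * K / Num.sqrt N%:R ^+ 3)).
  rewrite big_seq [leRHS]big_seq; apply: ler_sum => n.
  rewrite mem_index_iota; exact: step_avg.
rewrite sumr_const_nat -[leLHS]mulr_natr.
have C0 : 0 <= 248 * K / Num.sqrt N%:R ^+ 3.
  apply: divr_ge0; first exact: mulr_ge0.
  exact: exprn_ge0 (ltW s0).
have : (N - 1)%:R <= Num.sqrt N%:R ^+ 2 :> R by rewrite sqr_sqrtr // ler_nat leq_subr.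
move=> /(ler_wpM2l C0) /le_trans; apply.
rewrite le_eqVlt; apply/orP; left; apply/eqP.
by field; rewrite gt_eqF.
Qed.

Lemma smoothedN k :
  smoothed N k = Phi ((x - dev N k / Num.sqrt (var N)) / Num.sqrt e).
Proof.
rewrite /smoothed scale_sqr_var_N scaleN (mulrC _ (dev N k)) (_ : 1 + e - 1 = e) //.
by ring.
Qed.

End lindeberg.

(** * Removal of the smoothing *)

Section limit.
Variable R : realType.
Implicit Types (x eta delta eps M : R) (N k : nat).

Definition std_le x N k : R := (dev R N k / Num.sqrt (var R N) <= x)%R%:R.

Lemma heat_near x y e : 0 < e -> e <= 1 ->
  `|heat y (1 + e) - Phi x| <= `|y - x| + `|y| * e.
Proof.
move=> e0 e1; apply: le_trans (Phi_lipschitz _ _) _.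
set s := Num.sqrt _.
have s1 : 1 <= s by rewrite -[leLHS]sqrtr1 ler_wsqrtr //; lra.
have s2 : s ^+ 2 = 1 + e by rewrite sqr_sqrtr //; lra.
have s0 : 0 < s by lra.
have -> : y / s - x = (y - x) - y * (1 - s^-1) by field; rewrite gt_eqF.
apply: le_trans (ler_normB _ _) _; rewrite lerD2l normrM ler_wpM2l //.
have V1 : s^-1 <= 1 by rewrite invf_le1.
rewrite ger0_norm; last by lra.
have -> : 1 - s^-1 = (s - 1) / s by field; rewrite gt_eqF.
by rewrite ler_pdivrMr //; nra.
Qed.

(** Sandwich of an indicator between smoothed steps shifted by [delta]: once [delta] is at least [M]
    smoothing widths, only the tails of [Phi] beyond [M] remain as error. *)
Lemma std_le_smoothed x delta eta eps M N k : 0 < eps -> 0 < eta ->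
  1 - eta <= Phi M -> Phi (- M) <= eta -> M * eps <= delta ->
  let W := dev R N k / Num.sqrt (var R N) in
  Phi ((x - delta - W) / eps) - eta <= std_le x N k /\
  std_le x N k <= Phi ((x + delta - W) / eps) + eta.
Proof.
move=> eps0 eta0 M1 M2 Md W; rewrite /std_le -/W; move: W => W.
case: (leP W x) => Wx /=; rewrite ?mulr1n ?mulr0n; split.
- by have := Phi_le1 ((x - delta - W) / eps); lra.
- have : Phi M <= Phi ((x + delta - W) / eps) by rewrite le_Phi // ler_pdivlMr //; lra.
  by lra.
- have : Phi ((x - delta - W) / eps) <= Phi (- M) by rewrite le_Phi // ler_pdivrMr //; lra.
  by lra.
- by have := Phi_ge0 ((x + delta - W) / eps); lra.
Qed.

(** The three [eta] come from the sandwich, from the shift of [x], and from the variance [1 + e] in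
    place of 1. [C] depends on [eta] and [x] but not on [N]. *)
Lemma avg_std_le_close x eta : 0 < eta ->
  exists C, forall N, (1 < N)%N ->
  `|avg N (std_le x N) - Phi x| <= 3 * eta + C / Num.sqrt N%:R.
Proof.
move=> eta0; have [M M0 [M1 M2]] := Phi_tails eta0.
(* The first bound makes a shift by [eta] cover [M] smoothing widths; the second controls the effect
   of the extra variance at [x - eta] and [x + eta], and forces [eps <= 1]. *)
pose eps := Num.min (eta / M) (eta / (`|x| + eta)).
have xe0 : 0 < `|x| + eta by rewrite ltr_wpDl.
have eps0 : 0 < eps by rewrite /eps lt_min !divr_gt0.
have epsM : M * eps <= eta.
  by rewrite mulrC -ler_pdivlMr // /eps ge_min lexx.
have epsx : eps * (`|x| + eta) <= eta.
  by rewrite -ler_pdivlMr // /eps ge_min lexx orbT.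
have eps1 : eps <= 1.
  by have := normr_ge0 x; nra.
pose e := eps ^+ 2.
have e0 : 0 < e by rewrite exprn_gt0.
have e1 : e <= 1 by rewrite exprn_ile1 // ltW.
have se : Num.sqrt e = eps by rewrite sqrtr_sqr ger0_norm // ltW.
have eeps : e <= eps by rewrite /e expr2; nra.
exists (248 * (32 / e ^+ 2)) => N N1.
set C := _ / Num.sqrt _.
have ev k y : smoothed N e y N k =
    Phi ((y - dev R N k / Num.sqrt (var R N)) / eps).
  by rewrite smoothedN // se.
have close y : `|y| <= `|x| + eta -> `|y - x| <= eta ->
    `|avg N (smoothed N e y N) - Phi x| <= 2 * eta + C.
  move=> yx yd; have H := avg_smoothed_close y N1 e0 e1.
  have H2 := heat_near x y e0 e1.
  rewrite -(subrK (heat y (1 + e)) (avg _ _)) -addrA.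
  apply: le_trans (ler_normD _ _) _; rewrite [leRHS]addrC; apply: lerD => //.
  apply: le_trans H2 _.
  have : `|y| * e <= (`|x| + eta) * eps by apply: ler_pM => //; exact: ltW.
  by lra.
have up : `|x + eta| <= `|x| + eta.
  by apply: le_trans (ler_normD _ _) _; rewrite (ger0_norm (ltW eta0)).
have dn : `|x - eta| <= `|x| + eta.
  by apply: le_trans (ler_normB _ _) _; rewrite (ger0_norm (ltW eta0)).
have := close _ up; rewrite addrAC subrr add0r (ger0_norm (ltW eta0)) => /(_ (lexx _)) U.
have := close _ dn; rewrite addrAC subrr add0r normrN (ger0_norm (ltW eta0)) => /(_ (lexx _)) L.
have AU : avg N (std_le x N) <= avg N (smoothed N e (x + eta) N) + eta.
  rewrite -[X in _ + X](avg_cst N) -avgD; apply: le_avg => k _; rewrite ev.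
  by have [] := @std_le_smoothed x eta eta eps M N k.
have AL : avg N (smoothed N e (x - eta) N) - eta <= avg N (std_le x N).
  rewrite -[X in _ - X](avg_cst N) -avgB; apply: le_avg => k _; rewrite ev.
  by have [] := @std_le_smoothed x eta eta eps M N k.
move: U L; rewrite !ler_norml => /andP[U1 U2] /andP[L1 L2].
by apply/andP; split; lra.
Qed.

Lemma cvg_avg_std_le x : avg N (std_le x N) @[N --> \oo] --> Phi x.
Proof.
apply/cvgrPdist_le => eps eps0.
have [C H] := @avg_std_le_close x (eps / 4) (divr_gt0 eps0 (ltr0n _ 4)).
have Cs : \forall N \near \oo, C / Num.sqrt N%:R <= eps / 4.
  near=> N.
  have sN : 4 * `|C| / eps <= Num.sqrt N%:R.
    rewrite -[leLHS]ger0_norm; last by rewrite divr_ge0 ?mulr_ge0 // ltW.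
    rewrite -sqrtr_sqr ler_wsqrtr //.
    by near: N; exact: nbhs_infty_ger.
  have N0 : 0 < Num.sqrt N%:R :> R.
    by rewrite sqrtr_gt0 ltr0n; near: N; exact: nbhs_infty_gt.
  rewrite ler_pdivrMr //; apply: le_trans (ler_norm C) _.
  move: sN; rewrite ler_pdivrMr //; lra.
near=> N.
rewrite distrC; apply: le_trans (H N _) _.
  by near: N; exact: nbhs_infty_gt.
have : C / Num.sqrt N%:R <= eps / 4 by near: N.
by lra.
Unshelve. all: by end_near. Qed.

End limit.

(** * Moments and distribution function of the random variable *)

Section plateaux_moments.
Variables (R : realType) (n : nat).
Hypothesis n0 : (0 < n)%N.
Local Notation P := (stirling_unif R n).

Lemma expectation_plateaux_rv : 'E_P[plateaux_rv R n]%E = ((2 * n%:R + 1) / 3)%:E.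
Proof.
rewrite (expectation_plateaux n (fun k => k%:R)); congr EFin.
have := avg_dev R n0; rewrite /dev avgB avg_cst => /eqP.
by rewrite subr_eq0 => /eqP.
Qed.

Lemma variance_plateaux_rv : 'V_P[plateaux_rv R n]%E = (var R n)%:E.
Proof.
rewrite /variance unlock expectation_plateaux_rv /=.
rewrite -avg_dev_sqr // -expectation_plateaux.
by congr expectation; apply/funext => q; rewrite expr2.
Qed.

(** A probability is the expectation of an indicator, here a function of the number of plateaux. At
    [n = 1] both sides divide by zero with the same convention. *)
Lemma cdf_normalized_plateaux x :
  cdf (normalized P (plateaux_rv R n) : {RV P >-> R}) x = (avg n (std_le x n))%:E.
Proof.
rewrite /cdf /distribution /pushforward -expectation_indic //.
rewrite -expectation_plateaux; congr expectation; apply/funext => q.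
rewrite indicE /std_le /dev /=; congr (nat_of_bool _)%:R.
apply/idP/idP.
  move/set_mem; rewrite /= in_itv /= /normalized.
  by rewrite expectation_plateaux_rv variance_plateaux_rv.
move=> H; apply/mem_set; rewrite /= in_itv /= /normalized.
by rewrite expectation_plateaux_rv variance_plateaux_rv.
Qed.
End plateaux_moments.

Theorem theorem6 (R : realType) :
  cvg_in_distribution (stirling_unif R)
    (fun n => normalized (stirling_unif R n) (plateaux_rv R n))
    (normal_prob 0 1).
Proof.
move=> x _.
apply: (@cvg_trans _ (nbhs (Phi x)%:E)); last by rewrite EFin_Phi.
have H : (avg n (std_le x n))%:E @[n --> \oo] --> (Phi x)%:E.
  by apply: cvg_EFin; [near=> n|exact: cvg_avg_std_le].
(* The distribution functions agree with the averages from [n = 1] on, hence eventually. *)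
apply: cvg_trans H; apply: near_eq_cvg; near=> n.
rewrite cdf_normalized_plateaux //.
by near: n; exact: nbhs_infty_gt.
Unshelve. all: by end_near. Qed.
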